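(* Let $\mathbf{a}^{0}\subset\mathbf{a}^{1}$ be knot sequences in an interval $J\subset\mathbb{R}$, and let $\boldsymbol{\theta}^{0}$ (indexed by the $a\in\mathbf{a}^0$ with $a<\sup J$) and $\boldsymbol{\theta}^{1}$ (indexed by the $a\in\mathbf{a}^1$ with $a<\sup J$) be parameter sequences taking values in $(0,1)$. For $a\in\mathbf{a}^0$ let $a_+$ denote the successor of $a$ in $\mathbf{a}^0$. Let $\mathbf{b}^0:=\mathbf{b}(\mathbf{a}^0,\boldsymbol{\theta}^0)$, with elements $b^0_a$, and $\mathbf{b}^1:=\mathbf{b}(\mathbf{a}^1,\boldsymbol{\theta}^1)$ be such that, for every $a\in\mathbf{a}^0$ with $a<\sup J$: $b^0_a\in\mathbf{a}^1$ whenever $(a,a_+)$ contains some point of $\mathbf{a}^1$, and $b^0_a\in\mathbf{b}^1$ whenever $(a,a_+)$ contains no point of $\mathbf{a}^1$. Then $$S(\Omega_{\mathbf{a}^0,\boldsymbol{\theta}^0})\subset S(\Omega_{\mathbf{a}^1,\boldsymbol{\theta}^1}).$$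
   Context: A knot sequence in an interval $J\subset\mathbb{R}$ is a set $\mathbf{a}\subset J$ with at least three elements, having no cluster point in $J$, and with $\inf\mathbf{a}=\inf J$, $\sup\mathbf{a}=\sup J$. For $a\in\mathbf{a}$, $a_+$ and $a_-$ denote the successor and predecessor of $a$ in $\mathbf{a}$ (with $a_+=\infty$ if $a=\sup J$, $a_-=-\infty$ if $a=\inf J$). For a locally finite collection $\Omega\subset L^2(J)$, $S(\Omega):=\operatorname{clos}_{L^2(J)}\operatorname{span}(\Omega)$. Construction of $\Omega_{\mathbf{a},\boldsymbol{\theta}}$. Let $r(x)=x\chi_{[0,1)}(x)$, $l(x)=(1-x)\chi_{[0,1)}(x)$, $q=4rl$. For $0<\theta<1$ let $q_0^\theta(x)=q(x/\theta)$, $q_1^\theta(x)=q((x-\theta)/(1-\theta))$, $h^\theta(x)=r(x/\theta)+l((x-\theta)/(1-\theta))$. For each $\theta\in(0,1)$ there is a nonzero function $z^\theta\in\operatorname{span}\{q_0^\theta,q_1^\theta,h^\theta\}$ with $z^\theta\perp q$ and $(I-P_{\operatorname{span}\{q,z^\theta\}})r\perp l$ in $L^2([0,1])$, where $P_U$ denotes orthogonal projection onto $U$; fix one such $z^\theta$ for each $\theta$, once and for all. Put $r^\theta=(I-P_{\operatorname{span}\{q,z^\theta\}})r$ and $l^\theta=(I-P_{\operatorname{span}\{q,z^\theta\}})l$. Let $\boldsymbol{\theta}=(\theta_a)_{a\in\mathbf{a},\,a<\sup J}$ be a sequence in $(0,1)$. For $a\in\mathbf{a}$, $a<\sup J$,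 let $\sigma_a$ be the affine function with $\sigma_a(a)=0$, $\sigma_a(a_+)=1$, and $z_a:=z^{\theta_a}\circ\sigma_a$. Let $\breve\Omega_a=\{q\circ\sigma_a,z_a\}$ if $\inf J<a<a_+<\sup J$; $\breve\Omega_a=\{l^{\theta_a}\circ\sigma_a,q\circ\sigma_a,z_a\}$ if $a=\inf J$; $\breve\Omega_a=\{r^{\theta_a}\circ\sigma_a,q\circ\sigma_a,z_a\}$ if $a_+=\sup J$. For $\inf J<a<\sup J$ let $\bar\Omega_a=\{r^{\theta_{a_-}}\circ\sigma_{a_-}+l^{\theta_a}\circ\sigma_a\}$. Then $\Omega_{\mathbf{a},\boldsymbol{\theta}}$ is the union of all $\breve\Omega_a$ and $\bar\Omega_a$. $\mathbf{b}(\mathbf{a},\boldsymbol{\theta})$ is the sequence with elements $b_a:=(1-\theta_a)a+\theta_a a_+$, $a\in\mathbf{a}$, $a<\sup J$. *)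

(* Defs.v *)
From mathcomp Require Import all_boot all_order all_algebra.
From mathcomp Require Import all_classical all_reals all_analysis.

Set Implicit Arguments.
Unset Strict Implicit.
Unset Printing Implicit Defensive.
Import Order.TTheory GRing.Theory Num.Theory.
Import numFieldNormedType.Exports.

Local Open Scope classical_set_scope.
Local Open Scope ring_scope.

(* Elements of L^2(J) are represented by functions R -> R: the measure is
   Lebesgue measure restricted to J, so values outside J are irrelevant. *)

Section L2.
Variable R : realType.
Implicit Types (J : interval R) (f g p u : R -> R) (U Om : set (R -> R)).

Definition leb_on J : {measure set (measurableTypeR R) -> \bar R} :=
  mrestr (@lebesgue_measure R) (measurable_itv J).

Definition l2dot J f g : R :=
  (\int[@lebesgue_measure R]_(x in [set` J]) (f x * g x))%R.

Definition fspan Om : set (R -> R) :=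
  [set f | exists (n : nat) (c : 'I_n -> R) (g : 'I_n -> R -> R),
    (forall i, Om (g i)) /\ f = (fun x => \sum_(i < n) c i * g i x)].

(* The closure of the span in L^2(J), as a set of representatives.  It is
   saturated for a.e. equality on J, so inclusion between such sets is inclusion
   between the corresponding sets of classes. *)
Definition S_of J Om : set (R -> R) :=
  [set f | f \in Lfun (leb_on J) 2%:E /\
    forall e : R, 0 < e -> exists g, fspan Om g /\
      ('N[leb_on J]_2%:E [EFin \o (f \- g)%R] < e%:E)%E].

(* Orthogonal projection in L^2(J) onto U: the element p of U with f - p
   orthogonal to U.  It is only used for finite-dimensional spaces U of
   functions that are continuous on [0, 1] and vanish at 1 and off [0, 1]; there
   p exists and is unique as a function. *)
Definition l2proj J U f : R -> R :=
  xget (fun=> 0)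
    [set p | U p /\ forall u, U u -> l2dot J (f \- p) u = 0].

End L2.

Section Generators.
Variable R : realType.
Implicit Types (t x : R) (z : R -> R).

Definition r_ x : R := x * \1_(`[0, 1[%classic : set R) x.
Definition l_ x : R := (1 - x) * \1_(`[0, 1[%classic : set R) x.
Definition q_ x : R := 4 * r_ x * l_ x.

Definition q0_ t x : R := q_ (x / t).
Definition q1_ t x : R := q_ ((x - t) / (1 - t)).
Definition h_ t x : R := r_ (x / t) + l_ ((x - t) / (1 - t)).

(* (I - P_{span{q, z}}) f in L^2([0, 1]) *)
Definition qz_residual z (f : R -> R) : R -> R :=
  f \- l2proj `[0, 1] (fspan [set q_; z]) f.

Definition z_admissible t z : Prop :=
  [/\ fspan [set q0_ t; q1_ t; h_ t] z,
      z <> (fun=> 0),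
      l2dot `[0, 1] z q_ = 0 &
      l2dot `[0, 1] (qz_residual z r_) l_ = 0].

End Generators.

Section Knots.
Variable R : realType.
Implicit Types (J : interval R) (A : set R) (a : R) (th : R -> R).

Definition einf_itv J : \bar R := ereal_inf [set x%:E | x in [set` J]].
Definition esup_itv J : \bar R := ereal_sup [set x%:E | x in [set` J]].

Definition knot_sequence J A : Prop :=
  [/\ A `<=` [set` J],
      (`I_3 #<= A)%card,
      limit_point A `&` [set` J] = set0,
      ereal_inf [set x%:E | x in A] = einf_itv J &
      ereal_sup [set x%:E | x in A] = esup_itv J].

Definition knot_succ A a : \bar R :=
  xget +oo%E [set s%:E | s in
    [set s | [/\ A s, a < s & forall t, A t -> a < t -> s <= t]]].
Definition knot_pred A a : \bar R :=
  xget -oo%E [set s%:E | s in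
    [set s | [/\ A s, s < a & forall t, A t -> t < a -> t <= s]]].

(* A sequence theta indexed by the knots a < sup J is a function R -> R whose
   values at all other points are never used. *)
Definition parameter_sequence J A th : Prop :=
  forall a, A a -> (a%:E < esup_itv J)%E -> 0 < th a < 1.

(* For a < sup J the successor is finite, so that [fine] loses nothing here and
   below; likewise for the predecessor when inf J < a. *)
Definition knot_affine A a : R -> R :=
  fun x => (x - a) / (fine (knot_succ A a) - a).

Definition b_ A th a : R := (1 - th a) * a + th a * fine (knot_succ A a).

Definition b_seq J A th : set R :=
  [set b_ A th a | a in [set a | A a /\ (a%:E < esup_itv J)%E]].

(* z is the chosen family (z^theta), indexed by theta. *)
Definition Omega_breve J A th (z : R -> R -> R) a : set (R -> R) :=
  let s := knot_affine A a in
  let qs := @q_ R \o s in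
  let za := z (th a) \o s in
  let la := qz_residual (z (th a)) (@l_ R) \o s in
  let ra := qz_residual (z (th a)) (@r_ R) \o s in
  [set f | ((einf_itv J < a%:E)%E /\ (knot_succ A a < esup_itv J)%E) /\
           [set qs; za] f] `|`
  [set f | a%:E = einf_itv J /\ [set la; qs; za] f] `|`
  [set f | knot_succ A a = esup_itv J /\ [set ra; qs; za] f].

Definition Omega_bar A th (z : R -> R -> R) a : set (R -> R) :=
  let a' := fine (knot_pred A a) in
  [set (qz_residual (z (th a')) (@r_ R) \o knot_affine A a') \+
       (qz_residual (z (th a)) (@l_ R) \o knot_affine A a)].

Definition Omega J A th (z : R -> R -> R) : set (R -> R) :=
  [set f | exists a, [/\ A a, (a%:E < esup_itv J)%E &
             Omega_breve J A th z a f]] `|`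
  [set f | exists a, [/\ A a, (einf_itv J < a%:E)%E, (a%:E < esup_itv J)%E &
             Omega_bar A th z a f]].

End Knots.

(* Main.v *)
Require Import Defs.
From mathcomp Require Import all_boot all_order all_algebra.
From mathcomp Require Import all_classical all_reals all_analysis.
From mathcomp Require Import ring lra.

Set Implicit Arguments.
Unset Strict Implicit.
Unset Printing Implicit Defensive.
Import Order.TTheory GRing.Theory Num.Theory.
Import numFieldNormedType.Exports.

Local Open Scope classical_set_scope.
Local Open Scope ring_scope.

(** The inclusion already holds for the finite spans, pointwise.  Since
    [r^theta] and [l^theta] differ from [r] and [l] by elements of
    [span {q, z^theta}], the span of [Omega_{a, theta}] is that of the
    [q o sigma_a], the [z_a] and the hat functions of [a]; in particular it
    contains every compactly supported continuous piecewise quadratic function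
    with breakpoints in [a].  All generators for [a^0] are of this kind over
    [a^1], except the [z_a] with no point of [a^1] in [(a, a_+)]; for those, the
    hypothesis on [b^1] forces [theta^1_a = theta^0_a], so that [z_a] is itself
    a generator for [a^1]. *)

(** * Linear spans of function families *)

Section Span.
Variable R : realType.
Implicit Types (Om U : set (R -> R)) (f g s : R -> R).

Lemma fspan0 Om : fspan Om (fun=> 0).
Proof.
exists 0, (fun=> 0), (fun=> fun=> 0); split; first by case.
by apply/funext => x; rewrite big_ord0.
Qed.

Lemma fspan_gen Om g : Om g -> fspan Om g.
Proof.
move=> Omg; exists 1, (fun=> 1), (fun=> g); split => //.
by apply/funext => x; rewrite big_ord1 mul1r.
Qed.

Lemma fspanD Om f g : fspan Om f -> fspan Om g -> fspan Om (f \+ g).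
Proof.
move=> [n [c [F [OF ->]]]] [m [d [G [OG ->]]]].
pose pick T (a : 'I_n -> T) (b : 'I_m -> T) i :=
  match fintype.split i with inl j => a j | inr j => b j end.
exists (n + m)%N, (pick _ c d), (pick _ F G); split.
  by move=> i; rewrite /pick; case: fintype.split.
apply/funext => x /=; rewrite big_split_ord; congr +%R;
  apply: eq_bigr => i _; rewrite /pick.
  by case: split_ordP => j /eqP; rewrite (eq_lshift, eq_lrshift) // => /eqP ->.
by case: split_ordP => j /eqP; rewrite (eq_rshift, eq_rlshift) // => /eqP ->.
Qed.

Lemma fspanZ Om k f : fspan Om f -> fspan Om (fun x => k * f x).
Proof.
move=> [n [c [F [OF ->]]]]; exists n, (fun i => k * c i), F; split => //.
by apply/funext => x; rewrite mulr_sumr; apply: eq_bigr => i _; rewrite mulrA.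
Qed.

Lemma fspanB Om f g : fspan Om f -> fspan Om g -> fspan Om (f \- g).
Proof.
move=> Of Og; have := fspanD Of (fspanZ (-1) Og).
by congr (fspan Om _); apply/funext => x /=; rewrite mulN1r.
Qed.

(** Composition with [s] is linear, so generators suffice; [s] is later an affine map of a knot
    interval, or the identity. *)
Lemma fspan_comp U Om s f : (forall g, U g -> fspan Om (g \o s)) ->
  fspan U f -> fspan Om (f \o s).
Proof.
move=> UOm [n [c [F [UF ->]]]]; elim: n c F UF => [|n IH] c F UF.
  have := fspan0 Om; congr (fspan Om _).
  by apply/funext => x /=; rewrite big_ord0.
have := fspanD (fspanZ (c ord0) (UOm _ (UF ord0)))
  (IH (c \o lift ord0) (F \o lift ord0) (fun=> UF _)).
by congr (fspan Om _); apply/funext => x /=; rewrite big_ord_recl.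
Qed.

Lemma fspan_sub U Om : U `<=` fspan Om -> fspan U `<=` fspan Om.
Proof. by move=> UOm f; apply: (@fspan_comp _ _ id). Qed.

Lemma S_of_sub J U Om : fspan U `<=` fspan Om -> S_of J U `<=` S_of J Om.
Proof.
move=> UOm f [Lf clf]; split => // e e0.
by have [g [Ug fg]] := clf e e0; exists g; split => //; exact: UOm.
Qed.

(* This holds even without existence of the projection: the default value of
   [l2proj] is [0]. *)
Lemma l2proj_span J U f : fspan U (l2proj J (fspan U) f).
Proof. by rewrite /l2proj; case: xgetP => [p _ []//|_]; exact: fspan0. Qed.

(** The projection is a combination of [q_] and [z], so after composition with [s] a function and
    its residual agree modulo the span of [Om]. *)
Lemma l2proj_qz_comp Om z s f :
  fspan Om (@q_ R \o s) -> fspan Om (z \o s) ->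
  fspan Om (l2proj `[0, 1] (fspan [set @q_ R; z]) f \o s).
Proof.
move=> Oq Oz; apply: fspan_comp (l2proj_span _ _ _).
by move=> g [->|->].
Qed.

End Span.

(** * Truncated quadratic polynomials *)

Section Pieces.
Variable R : realType.
Implicit Types (x u v w t : R) (p : R -> R).

Definition affine_to01 u v x := (x - u) / (v - u).

Definition quad (k0 k1 k2 : R) x := k0 + k1 * x + k2 * x ^+ 2.

(** Half-open, as in [r_] and [l_], so that adjacent pieces add up at every point. *)
Definition cut p u v x := p x * \1_(`[u, v[%classic : set R) x.

Lemma indic_co u v x :
  \1_(`[u, v[%classic : set R) x = ((u <= x) && (x < v))%:R :> R.
Proof. by rewrite indicE mem_setE in_itv. Qed.

Lemma indic_affine u v x : u < v ->
  \1_(`[0, 1[%classic : set R) (affine_to01 u v x) =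
  \1_(`[u, v[%classic : set R) x :> R.
Proof.
move=> uv; have d0 : 0 < v - u by rewrite subr_gt0.
rewrite !indic_co /affine_to01 ltr_pdivrMr // mul1r ltrD2r.
by rewrite pmulr_lge0 ?invr_gt0 // subr_ge0.
Qed.

Lemma indic_coU u v w x : u <= v -> v <= w ->
  \1_(`[u, w[%classic : set R) x =
  \1_(`[u, v[%classic : set R) x + \1_(`[v, w[%classic : set R) x :> R.
Proof.
move=> uv vw; rewrite !indic_co; have [xv|vx] := ltP x v.
  by rewrite (lt_le_trans xv vw) andbT addr0.
by rewrite (le_trans uv vx) andbF add0r.
Qed.

Lemma q_E x :
  q_ x = 4 * x * (1 - x) * \1_(`[0, 1[%classic : set R) x :> R.
Proof. by rewrite /q_ /r_ /l_ indic_co; case: (_ && _) => /=; ring. Qed.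

(** The endpoint values recorded here and for [l_] and [q_] decide which half-hats survive in
    [span_cut]. *)
Lemma r_cut u v : u < v -> exists k0 k1 k2,
  [/\ @r_ R \o affine_to01 u v = cut (quad k0 k1 k2) u v,
      quad k0 k1 k2 u = 0 & quad k0 k1 k2 v = 1].
Proof.
move=> uv; have d0 : v - u != 0 by rewrite subr_eq0 gt_eqF.
exists (- u / (v - u)), (v - u)^-1, 0; rewrite /quad; split; [|by field|by field].
by apply/funext => x; rewrite /= /r_ indic_affine // /cut /affine_to01; field.
Qed.

Lemma l_cut u v : u < v -> exists k0 k1 k2,
  [/\ @l_ R \o affine_to01 u v = cut (quad k0 k1 k2) u v,
      quad k0 k1 k2 u = 1 & quad k0 k1 k2 v = 0].
Proof.
move=> uv; have d0 : v - u != 0 by rewrite subr_eq0 gt_eqF.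
exists (v / (v - u)), (- (v - u)^-1), 0; rewrite /quad.
split; [|by field|by field].
by apply/funext => x; rewrite /= /l_ indic_affine // /cut /affine_to01; field.
Qed.

Lemma q_cut u v : u < v -> exists k0 k1 k2,
  [/\ @q_ R \o affine_to01 u v = cut (quad k0 k1 k2) u v,
      quad k0 k1 k2 u = 0 & quad k0 k1 k2 v = 0].
Proof.
move=> uv; have d0 : v - u != 0 by rewrite subr_eq0 gt_eqF.
exists (- 4 * u * v / (v - u) ^+ 2), (4 * (u + v) / (v - u) ^+ 2),
  (- 4 / (v - u) ^+ 2); rewrite /quad; split; [|by field|by field].
apply/funext => x; rewrite /= q_E indic_affine // /cut /affine_to01.
by field.
Qed.

(** The quadratic minus its linear interpolant at [u] and [v] is [k2 * (x - u) * (x - v)], a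
    multiple of the rescaled [q_], whose leading coefficient is [- 4 / (v - u) ^+ 2]. *)
Lemma cut_quadE k0 k1 k2 u v x : u < v ->
  cut (quad k0 k1 k2) u v x =
  quad k0 k1 k2 u * l_ (affine_to01 u v x) +
  quad k0 k1 k2 v * r_ (affine_to01 u v x) -
  k2 * (v - u) ^+ 2 / 4 * q_ (affine_to01 u v x).
Proof.
move=> uv; have d0 : v - u != 0 by rewrite subr_eq0 gt_eqF.
rewrite q_E /l_ /r_ indic_affine // /cut /affine_to01 /quad.
by field.
Qed.

End Pieces.

(** * Order structure of a knot sequence *)

Section Knots.
Variables (R : realType) (J : interval R) (A : set R).
Hypothesis hA : knot_sequence J A.
Implicit Types (a s t u v : R) (B : set R).

Definition consecutive a s :=
  [/\ A a, A s, a < s & forall t, A t -> a < t -> s <= t].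

Lemma knot_in a : A a -> [set` J] a.
Proof. by case: hA => AJ _ _ _ _; exact: AJ. Qed.

(** Applied to an infimum or supremum of knots not yet known to be attained, so [t] is any point of
    [J]. *)
Lemma knot_nlimit t : [set` J] t ->
  exists2 e, 0 < e & forall s, A s -> `|s - t| < e -> s = t.
Proof.
move=> Jt; case: hA => _ _ lim0 _ _; apply: contrapT => noe.
suff : (limit_point A `&` [set` J]) t by rewrite lim0.
split => // U /nbhs_ballP[e /= e0 eU]; apply: contrapT => noy.
apply: noe; exists e => // s As se; apply: contrapT => /eqP st; apply: noy.
by exists s; split => //; apply: eU; rewrite /ball /= distrC.
Qed.

(** The bound [t] in [J] keeps [inf B] inside the interval, where knots do not accumulate; a point
    of [B] close enough to the infimum then equals it. *)
Lemma knots_min B t : B `<=` A -> B !=set0 -> [set` J] t -> lbound B t ->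
  exists2 s, B s & lbound B s.
Proof.
move=> BA [b Bb] Jt Bt; have hB : has_inf B by split; [exists b|exists t].
have lbB : lbound B (inf B) by apply: ge_inf; exists t.
exists (inf B) => //; have [|e e0 eA] := @knot_nlimit (inf B).
  apply: (interval_is_interval Jt (knot_in (BA _ Bb))).
  by rewrite lbB // andbT; apply: lb_le_inf => //; exists b.
have [s Bs sB] := inf_adherent e0 hB.
have <- // : s = inf B.
apply: eA; first exact: BA.
by rewrite ger0_norm ?ltrBlDl // subr_ge0 lbB.
Qed.

Lemma knots_max B t : B `<=` A -> B !=set0 -> [set` J] t -> ubound B t ->
  exists2 s, B s & ubound B s.
Proof.
move=> BA [b Bb] Jt Bt; have hB : has_sup B by split; [exists b|exists t].
have ubB : ubound B (sup B) by apply: ub_le_sup; exists t.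
exists (sup B) => //; have [|e e0 eA] := @knot_nlimit (sup B).
  apply: (interval_is_interval (knot_in (BA _ Bb)) Jt).
  by rewrite ubB //=; apply: ge_sup => //; exists b.
have [s Bs sB] := sup_adherent e0 hB.
have <- // : s = sup B.
apply: eA; first exact: BA.
by rewrite distrC ger0_norm ?ltrBlDr -?ltrBlDl ?subr_ge0 ?ubB // ltrBlDr -ltrBlDr.
Qed.

Lemma knot_le_esup a : A a -> (a%:E <= esup_itv J)%E.
Proof. by move=> /knot_in Ja; apply: ereal_sup_ubound; exists a. Qed.

Lemma knot_ge_einf a : A a -> (einf_itv J <= a%:E)%E.
Proof. by move=> /knot_in Ja; apply: ereal_inf_lbound; exists a. Qed.

(** Since the knots have the same supremum as [J], some knot exceeds [a]; the least such knot is the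
    successor. *)
Lemma consecutive_ex a : A a -> (a%:E < esup_itv J)%E ->
  exists s, consecutive a s.
Proof.
move=> Aa; have [_ _ _ _ <-] := hA => /ereal_sup_gt[_ [t At <-]].
rewrite lte_fin => a_t.
have [//|||/=|s [As lt_as] ls] := @knots_min [set s | A s /\ a < s] a.
- by move=> ? [].
- by exists t.
- exact: knot_in.
- by move=> s [_ /ltW].
by exists s; split => // v Av av; exact: ls.
Qed.

Lemma consecutive_pred_ex s : A s -> (einf_itv J < s%:E)%E ->
  exists a, consecutive a s.
Proof.
move=> As; have [_ _ _ <- _] := hA => /ereal_inf_lt[_ [t At <-]].
rewrite lte_fin => ts.
have [//|||/=|a [Aa lt_as] ua] := @knots_max [set a | A a /\ a < s] s.
- by move=> ? [].
- by exists t.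
- exact: knot_in.
- by move=> a [_ /ltW].
exists a; split => // v Av av; rewrite leNgt; apply/negP => vs.
by move: av; rewrite ltNge ua.
Qed.

Lemma consecutive_succ a s : consecutive a s -> knot_succ A a = s%:E.
Proof.
move=> [Aa As lt_as le_s]; apply: xget_unique; first by exists s.
move=> _ [t [At lt_at le_t] <-]; congr _%:E.
by apply/eqP; rewrite eq_le le_t // le_s.
Qed.

Lemma consecutive_pred a s : consecutive a s -> knot_pred A s = a%:E.
Proof.
move=> [Aa As lt_as le_s].
have le_a t : A t -> t < s -> t <= a.
  by move=> At ts; rewrite leNgt; apply/negP => /(le_s t At); rewrite leNgt ts.
apply: xget_unique; first by exists a.
move=> _ [t [At lt_ts le_t] <-]; congr _%:E.
by apply/eqP; rewrite eq_le le_t // le_a.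
Qed.

Lemma consecutive_affine a s : consecutive a s ->
  knot_affine A a = affine_to01 a s.
Proof. by move=> /consecutive_succ as'; rewrite /knot_affine as'. Qed.

Lemma consecutive_esup a s : consecutive a s -> (a%:E < esup_itv J)%E.
Proof.
by move=> [_ As lt_as _]; apply: lt_le_trans (knot_le_esup As); rewrite lte_fin.
Qed.

Lemma consecutive_einf a s : consecutive a s -> (einf_itv J < s%:E)%E.
Proof.
by move=> [Aa _ lt_as _]; apply: le_lt_trans (knot_ge_einf Aa) _; rewrite lte_fin.
Qed.

(** By least counterexample, whose predecessor satisfies [P]; no counting of the knots between [u]
    and [v] is involved. *)
Lemma knot_ind (P : R -> Prop) u v : A u -> A v -> u <= v -> P u ->
  (forall t s, u <= t -> consecutive t s -> P t -> P s) -> P v.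
Proof.
move=> Au Av uv Pu Pstep; apply: contrapT => nPv.
have [||||s [As us nPs] ls] := @knots_min [set t | [/\ A t, u <= t & ~ P t]] u.
- by move=> t [].
- by exists v.
- exact: knot_in.
- by move=> t [].
have lt_us : u < s.
  by rewrite lt_neqAle us andbT; apply/eqP => us'; apply: nPs; rewrite -us'.
have [|t ts] := @consecutive_pred_ex s As.
  by apply: le_lt_trans (knot_ge_einf Au) _; rewrite lte_fin.
have ut : u <= t.
  case: (ts) => At _ _ le_s; rewrite leNgt; apply/negP => /(le_s u Au).
  by rewrite leNgt lt_us.
apply: nPs; apply: (Pstep t) => //; apply: contrapT => nPt.
case: ts => At _ lt_ts _; have := ls t; rewrite leNgt lt_ts /=.
by move=> /(_ _)/negP; apply => //.
Qed.

End Knots.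

(** * Piecewise quadratics in the span over one knot sequence *)

Section KnotSpan.
Variables (R : realType) (z : R -> R -> R) (J : interval R) (A : set R).
Variable th : R -> R.
Hypothesis hA : knot_sequence J A.
Implicit Types (a s t u v x : R).

Let W := fspan (Omega J A th z).

(* The two halves of the hat function at the knot [u]. *)
Definition ltail u : R -> R :=
  if (u%:E < esup_itv J)%E then @l_ R \o knot_affine A u else fun=> 0.

Definition rtail u : R -> R :=
  if (einf_itv J < u%:E)%E then @r_ R \o knot_affine A (fine (knot_pred A u))
  else fun=> 0.

Lemma ltail_consecutive a s : consecutive A a s ->
  ltail a = @l_ R \o affine_to01 a s.
Proof.
move=> as'; rewrite /ltail (consecutive_esup hA as').
by rewrite (consecutive_affine as').
Qed.

Lemma rtail_consecutive a s : consecutive A a s ->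
  rtail s = @r_ R \o affine_to01 a s.
Proof.
move=> as'; rewrite /rtail (consecutive_einf hA as') (consecutive_pred as') /=.
by rewrite (consecutive_affine as').
Qed.

(** All three shapes of [Omega_breve] contain these two functions; the cases on [a] and [s] select
    one that applies. *)
Lemma Omega_breve_qz a s f : consecutive A a s ->
  [set @q_ R \o affine_to01 a s; z (th a) \o affine_to01 a s] f ->
  Omega J A th z f.
Proof.
move=> as' f_qz; left; exists a.
have [Aa As lt_as _] := as'; split => //; first exact: consecutive_esup as'.
rewrite /Omega_breve (consecutive_affine as') (consecutive_succ as').
have := knot_ge_einf hA Aa; rewrite le_eqVlt => /predU1P[a_inf|inf_a].
  left; right; split => //.
  by case: f_qz => ->; [left; right|right].
have := knot_le_esup hA As; rewrite le_eqVlt => /predU1P[s_sup|s_sup].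
  right; split => //.
  by case: f_qz => ->; [left; right|right].
by left; left.
Qed.

Lemma span_q a s : consecutive A a s -> W (@q_ R \o affine_to01 a s).
Proof. by move=> as'; apply/fspan_gen/(Omega_breve_qz as'); left. Qed.

Lemma span_z a s : consecutive A a s -> W (z (th a) \o affine_to01 a s).
Proof. by move=> as'; apply/fspan_gen/(Omega_breve_qz as'); right. Qed.

Let span_proj a s f (as' : consecutive A a s) :=
  l2proj_qz_comp f (span_q as') (span_z as').

(** Adding back the projections, which lie in the span, turns the residuals in the generator at [u]
    into [r_] and [l_]; at an end of [J] the missing half is zero. *)
Lemma span_hat u : A u -> W (ltail u \+ rtail u).
Proof.
move=> Au.
have := knot_ge_einf hA Au; rewrite le_eqVlt => /predU1P[u_inf|inf_u].
  have := knot_le_esup hA Au; rewrite le_eqVlt => /predU1P[u_sup|u_sup].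
    have := fspan0 (Omega J A th z); congr (fspan _ _); apply/funext => x.
    by rewrite /ltail /rtail u_inf -u_sup !ltxx /= addr0.
  have [s us] := consecutive_ex hA Au u_sup.
  have Ol : Omega J A th z (qz_residual (z (th u)) (@l_ R) \o affine_to01 u s).
    left; exists u; split => //; left; right; split => //.
    by rewrite (consecutive_affine us); left; left.
  have := fspanD (fspan_gen Ol) (span_proj (@l_ R) us).
  rewrite (ltail_consecutive us) /rtail u_inf ltxx.
  congr (fspan _ _); apply/funext => x /=.
  by rewrite /qz_residual /= subrK addr0.
have [a au] := consecutive_pred_ex hA Au inf_u.
have := knot_le_esup hA Au; rewrite le_eqVlt => /predU1P[u_sup|u_sup].
  have Or : Omega J A th z (qz_residual (z (th a)) (@r_ R) \o affine_to01 a u).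
    left; exists a; case: (au) => Aa _ _ _; split => //.
      exact: consecutive_esup au.
    right; rewrite (consecutive_succ au) (consecutive_affine au); split => //.
    by left; left.
  have := fspanD (fspan_gen Or) (span_proj (@r_ R) au).
  rewrite (rtail_consecutive au) /ltail -u_sup ltxx.
  congr (fspan _ _); apply/funext => x /=.
  by rewrite /qz_residual /= subrK add0r.
have [s us] := consecutive_ex hA Au u_sup.
have Ob : Omega J A th z
  ((qz_residual (z (th a)) (@r_ R) \o affine_to01 a u) \+
   (qz_residual (z (th u)) (@l_ R) \o affine_to01 u s)).
  right; exists u; split => //; rewrite /Omega_bar (consecutive_pred au) /=.
  by rewrite (consecutive_affine au) (consecutive_affine us).
have := fspanD (fspan_gen Ob)
  (fspanD (span_proj (@r_ R) au) (span_proj (@l_ R) us)).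
rewrite (ltail_consecutive us) (rtail_consecutive au).
congr (fspan _ _); apply/funext => x /=.
by rewrite /qz_residual /=; ring.
Qed.

(* The half-hats at the ends continue the truncation continuously; this form is
   additive in [u, v] modulo the hat functions, whence the induction over
   knots. *)
Lemma span_cut k0 k1 k2 u v : A u -> A v -> u <= v ->
  let p := quad k0 k1 k2 in
  W (fun x => cut p u v x + p v * ltail v x + p u * rtail u x).
Proof.
move=> Au Av uv p; apply: (knot_ind hA Au Av uv (P := fun v =>
  W (fun x => cut p u v x + p v * ltail v x + p u * rtail u x))).
  have := fspanZ (p u) (span_hat Au); congr (fspan _ _); apply/funext => x /=.
  by rewrite /cut set_itvco0 indic0 mulr0 add0r mulrDr.
move=> t s ut ts Wt; have [At As lt_ts _] := ts.
(* By [cut_quadE], the terms in [ltail t], [rtail s] and [q_] assemble to the piece of [p] on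
   [[t, s)], leaving [p s * ltail s]. *)
have := fspanD Wt (fspanB (fspanZ (p s) (span_hat As))
  (fspanZ (k2 * (s - t) ^+ 2 / 4) (span_q ts))).
congr (fspan _ _); apply/funext => x /=.
have := cut_quadE k0 k1 k2 x lt_ts; rewrite -/p /cut => cut_ts.
rewrite (indic_coU x ut (ltW lt_ts)) [p x * (_ + _)]mulrDr cut_ts.
by rewrite (rtail_consecutive ts) (ltail_consecutive ts) /=; ring.
Qed.

(** [q_] vanishes at both ends, so no half-hat remains, whatever knots lie between [u] and [v]. *)
Lemma span_q_knots u v : A u -> A v -> u < v -> W (@q_ R \o affine_to01 u v).
Proof.
move=> Au Av uv; have [k0 [k1 [k2 [-> pu pv]]]] := q_cut uv.
have := span_cut k0 k1 k2 Au Av (ltW uv); rewrite /= pu pv.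
by congr (fspan _ _); apply/funext => x; rewrite !mul0r !addr0.
Qed.

Lemma span_r_knots u v : A u -> A v -> u < v ->
  W ((@r_ R \o affine_to01 u v) \+ ltail v).
Proof.
move=> Au Av uv; have [k0 [k1 [k2 [-> pu pv]]]] := r_cut uv.
have := span_cut k0 k1 k2 Au Av (ltW uv); rewrite /= pu pv.
by congr (fspan _ _); apply/funext => x /=; rewrite mul0r addr0 mul1r.
Qed.

Lemma span_l_knots u v : A u -> A v -> u < v ->
  W ((@l_ R \o affine_to01 u v) \+ rtail u).
Proof.
move=> Au Av uv; have [k0 [k1 [k2 [-> pu pv]]]] := l_cut uv.
have := span_cut k0 k1 k2 Au Av (ltW uv); rewrite /= pu pv.
by congr (fspan _ _); apply/funext => x /=; rewrite mul0r addr0 mul1r.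
Qed.

(** The affine map carries the breakpoint [t] to a knot, so [q0_] and [q1_] become copies of [q_] on
    the two subintervals and [h_] a hat peaking at that knot. *)
Lemma span_z_knots t u v f : A u -> A v -> u < v -> 0 < t < 1 ->
  A ((1 - t) * u + t * v) -> fspan [set q0_ t; q1_ t; h_ t] f ->
  W (f \o affine_to01 u v).
Proof.
set b := (1 - t) * u + t * v => Au Av uv /andP[t0 t1] Ab.
have ub : u < b by rewrite /b; nra.
have bv : b < v by rewrite /b; nra.
have tN0 : t != 0 by rewrite gt_eqF.
have t'N0 : 1 - t != 0 by rewrite subr_eq0 gt_eqF.
have dN0 : v - u != 0 by rewrite subr_eq0 gt_eqF.
have buE : b - u = t * (v - u) by rewrite /b; ring.
have vbE : v - b = (1 - t) * (v - u) by rewrite /b; ring.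
have left_half x : affine_to01 u v x / t = affine_to01 u b x.
  by rewrite /affine_to01 buE; field; rewrite dN0 tN0.
have right_half x : (affine_to01 u v x - t) / (1 - t) = affine_to01 b v x.
  by rewrite /affine_to01 vbE /b; field; rewrite dN0 t'N0.
apply: fspan_comp => g [[->|->]|->].
- have := span_q_knots Au Ab ub; congr (fspan _ _); apply/funext => x /=.
  by rewrite /q0_ left_half.
- have := span_q_knots Ab Av bv; congr (fspan _ _); apply/funext => x /=.
  by rewrite /q1_ right_half.
(* The leftovers [ltail b] and [rtail b] of the two slopes form the hat at [b], which is
   subtracted. *)
have := fspanB (fspanD (span_r_knots Au Ab ub) (span_l_knots Ab Av bv))
  (span_hat Ab).
congr (fspan _ _); apply/funext => x /=.
by rewrite /h_ left_half right_half; ring.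
Qed.

End KnotSpan.

(** * Comparison of the generators for two nested knot sequences *)

Theorem lemma5 (R : realType) (z : R -> R -> R)
    (hz : forall t : R, 0 < t < 1 -> z_admissible t (z t))
    (J : interval R) (A0 A1 : set R) (th0 th1 : R -> R)
    (hA0 : knot_sequence J A0) (hA1 : knot_sequence J A1)
    (hA01 : A0 `<=` A1)
    (hth0 : parameter_sequence J A0 th0) (hth1 : parameter_sequence J A1 th1)
    (hb : forall a : R, A0 a -> (a%:E < esup_itv J)%E ->
      (A1 `&` `]a, fine (knot_succ A0 a)[%classic !=set0 -> A1 (b_ A0 th0 a)) /\
      (A1 `&` `]a, fine (knot_succ A0 a)[%classic = set0 ->
         b_seq J A1 th1 (b_ A0 th0 a))) :
  S_of J (Omega J A0 th0 z) `<=` S_of J (Omega J A1 th1 z).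
Proof.
apply/S_of_sub/fspan_sub.
have Wq a s : consecutive A0 a s ->
    fspan (Omega J A1 th1 z) (@q_ R \o affine_to01 a s).
  by case=> /hA01 ? /hA01 ? ? _; exact: span_q_knots.
have Wz a s : consecutive A0 a s ->
    fspan (Omega J A1 th1 z) (z (th0 a) \o affine_to01 a s).
  move=> as'; have [A0a A0s lt_as _] := as'.
  have a_sup := consecutive_esup hA0 as'.
  have th0a := hth0 _ A0a a_sup.
  have [+ +] := hb _ A0a a_sup; rewrite /b_ (consecutive_succ as') /=.
  (* If [A1] meets [(a, s)], then [b] is a knot of [A1] and [span_z_knots] applies; otherwise the
     parameters must coincide. *)
  set b := _ + _; have [/eqP E _ /(_ E)|/set0P N /(_ N) A1b _] :=
    boolP (A1 `&` `]a, s[%classic == set0); last first.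
    apply: (@span_z_knots _ _ _ _ _ hA1 (th0 a)); rewrite ?/b //.
    - exact: hA01.
    - exact: hA01.
    - by have [] := hz _ th0a.
  have {}as' : consecutive A1 a s.
    split; [exact: hA01|exact: hA01|by []|].
    move=> t A1t a_t; rewrite leNgt; apply/negP => ts.
    suff : (A1 `&` `]a, s[%classic) t by rewrite E.
    by split; rewrite //= in_itv /= a_t.
  move=> [a' [A1a' a'_sup]].
  have [s' a's'] := consecutive_ex hA1 A1a' a'_sup.
  have /andP[th1_gt0 th1_lt1] := hth1 _ A1a' a'_sup.
  have /andP[th0_gt0 th0_lt1] := th0a.
  rewrite /b_ (consecutive_succ a's') /= => bE.
  have [_ A1s' lt_a's' le_s'] := a's'; have [A1a A1s _ le_s] := as'.
  (* The gaps [(a, s)] and [(a', s')] between consecutive knots of [A1] share the point [b], hence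
     coincide. *)
  have a'E : a' = a.
    apply/eqP; rewrite eq_le; apply/andP; split; rewrite leNgt; apply/negP.
      by move=> /(le_s _ A1a'); rewrite leNgt; apply/negP/negPn; rewrite /b in bE; nra.
    by move=> /(le_s' _ A1a); rewrite leNgt; apply/negP/negPn; rewrite /b in bE; nra.
  subst a'; have s'E : s' = s.
    by apply/eqP; rewrite eq_le le_s' // le_s.
  subst s'; suff -> : th0 a = th1 a by exact: span_z.
  (* As [a < s], the point [b] determines its barycentric parameter. *)
  by rewrite /b in bE; nra.
have Wproj a s f (as' : consecutive A0 a s) :=
  l2proj_qz_comp f (Wq a s as') (Wz a s as').
(* Half-hats of [A1] compensate the end value 1 of [l_] at [a] and, next, that of [r_] at [s]. *)
have Wl a s : consecutive A0 a s -> fspan (Omega J A1 th1 z)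
    ((qz_residual (z (th0 a)) (@l_ R) \o affine_to01 a s) \+ rtail J A1 a).
  move=> as'; have [/hA01 A1a /hA01 A1s lt_as _] := as'.
  have := fspanB (span_l_knots z th1 hA1 A1a A1s lt_as) (Wproj _ _ (@l_ R) as').
  by congr (fspan _ _); apply/funext => x /=; rewrite addrAC.
have Wr a s : consecutive A0 a s -> fspan (Omega J A1 th1 z)
    ((qz_residual (z (th0 a)) (@r_ R) \o affine_to01 a s) \+ ltail J A1 s).
  move=> as'; have [/hA01 A1a /hA01 A1s lt_as _] := as'.
  have := fspanB (span_r_knots z th1 hA1 A1a A1s lt_as) (Wproj _ _ (@r_ R) as').
  by congr (fspan _ _); apply/funext => x /=; rewrite addrAC.
move=> f [[a [A0a a_sup]]|[a [A0a inf_a a_sup]]]; have [s as'] :=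
  consecutive_ex hA0 A0a a_sup.
  rewrite /Omega_breve (consecutive_affine as') (consecutive_succ as').
  move=> [[[_]|[a_inf]]|[s_sup]].
  - by move=> [->|->]; [exact: Wq|exact: Wz].
  - move=> [[->|->]|->]; [|exact: Wq|exact: Wz].
    (* At an end of [J] the compensating half-hat is zero by definition. *)
    have := Wl _ _ as'; rewrite /rtail a_inf ltxx.
    by congr (fspan _ _); apply/funext => x /=; rewrite addr0.
  move=> [[->|->]|->]; [|exact: Wq|exact: Wz].
  have := Wr _ _ as'; rewrite /ltail s_sup ltxx.
  by congr (fspan _ _); apply/funext => x /=; rewrite addr0.
have [a' a'a] := consecutive_pred_ex hA0 A0a inf_a.
rewrite /Omega_bar (consecutive_pred a'a) /= (consecutive_affine a'a).
rewrite (consecutive_affine as') => ->.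
(* At an interior knot the two compensating halves form the hat of [A1] at [a], itself in the
   span. *)
have := fspanB (fspanD (Wr _ _ a'a) (Wl _ _ as'))
  (span_hat z th1 hA1 (hA01 _ A0a)).
by congr (fspan _ _); apply/funext => x /=; ring.
Qed.
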